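(* For every positive integer $d$ there is a constant $C_d$ such that for every $(d+1)$-dimensional simplicial polytope $\mathbf{P}$ on $n$ vertices, $\chi(\mathcal{F}(\mathbf{P}))\leq C_d\, n^{\frac{\lceil d/2\rceil-1}{d}}$ (for $n\ge 1$); i.e. $\chi(\mathcal{F}(\mathbf{P}))\in O(n^{\frac{\lceil d/2\rceil-1}{d}})$.
   Context: For a polytope $\mathbf{P}$, $\mathcal{F}(\mathbf{P})$ is the hypergraph on the vertex set of $\mathbf{P}$ whose hyperedges are the vertex sets of the facets. For a hypergraph $\mathcal{H}$, a (weak) coloring with $m$ colors is a map $c:V(\mathcal{H})\to[m]$ such that no hyperedge is contained in a single color class $c^{-1}(i)$; $\chi(\mathcal{H})$ is the minimum number of colors of such a coloring. *)

(* Defs.v *)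
From HB Require Import structures.
From mathcomp Require Import all_boot all_order all_algebra.
From mathcomp Require Import boolp reals exp Rstruct.

Set Implicit Arguments.
Unset Strict Implicit.
Unset Printing Implicit Defensive.
Import Order.TTheory GRing.Theory Num.Theory.
Local Open Scope ring_scope.

Definition hypergraph (V : finType) := {set V} -> Prop.

Definition is_coloring (V : finType) (H : hypergraph V) (m : nat)
  (c : V -> 'I_m) : Prop :=
  forall E : {set V}, H E -> forall i : 'I_m, ~ (E \subset [set x | c x == i]).

Definition colorable (V : finType) (H : hypergraph V) (m : nat) : Prop :=
  exists c : V -> 'I_m, is_coloring H c.

(* chromatic number: least m such that H admits a coloring with m colors.
   (A coloring with m colors exists for some m <= #|V| whenever H has one
   at all; if H admits no coloring the value #|V|.+1 is returned — this
   case never occurs for facet hypergraphs of polytopes.) *)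
Definition chi (V : finType) (H : hypergraph V) : nat :=
  find (fun m => `[< colorable H m >]) (iota 0 #|V|.+1).

(* A polytope in Rdefinitions.R^D is given by a finite family of points
   v : 'I_n -> 'rV[Rdefinitions.R]_D; P = conv {v i}.  We require the points to be in
   convex position, so that they are exactly the vertices of P. *)

Section Polytopes.
Variables (D n : nat) (v : 'I_n -> 'rV[Rdefinitions.R]_D).

Definition in_conv (S : {set 'I_n}) (x : 'rV[Rdefinitions.R]_D) : Prop :=
  exists lam : 'I_n -> Rdefinitions.R,
    [/\ forall j, 0 <= lam j,
        forall j, j \notin S -> lam j = 0,
        \sum_j lam j = 1 &
        \sum_j lam j *: v j = x].

Definition convex_position : Prop :=
  forall i, ~ in_conv [set j | j != i] (v i).

Definition hom_mx (S : {set 'I_n}) : 'M[Rdefinitions.R]_(n, D + 1) :=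
  \matrix_(i < n) (if i \in S then row_mx (v i) (const_mx 1) else 0).

(* affine dimension of {v i | i in S} plus one *)
Definition aff_rank (S : {set 'I_n}) : nat := \rank (hom_mx S).

Definition full_dimensional : Prop := aff_rank setT = D.+1.

Definition lin (a : 'cV[Rdefinitions.R]_D) (x : 'rV[Rdefinitions.R]_D) : Rdefinitions.R := (x *m a) 0 0.

(* F is the vertex set of a facet: the vertices on a supporting hyperplane
   {a . x = b} (with a . v i <= b for all i), spanning an affine subspace
   of dimension D - 1. *)
Definition is_facet (F : {set 'I_n}) : Prop :=
  exists (a : 'cV[Rdefinitions.R]_D) (b : Rdefinitions.R),
    [/\ forall i, lin a (v i) <= b,
        F = [set i | lin a (v i) == b] &
        aff_rank F = D].

Definition facet_hypergraph : hypergraph 'I_n := is_facet.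

Definition simplicial_polytope : Prop :=
  [/\ convex_position, full_dimensional &
      forall F, is_facet F -> #|F| = D].

End Polytopes.

(* Main.v *)
(* Translate an interior point of the polytope to the origin and normalize the
   facet normals, so that a facet E has a normal a_E with a_E . w <= 1 on the
   vertices, with equality exactly on E. The vertices of E form a basis; expand
   a generic vector c in it. Then a_E is the unique maximizer of c . a over the
   normals of the facets that contain the vertices of E having a negative
   coefficient, so E is determined by these vertices, and by symmetry also by
   those having a positive coefficient. One of the two sets has at most
   k = ceil(d/2) elements, so a set W of vertices contains O(|W|^k) facets.

   For k = 1 the hypergraph is therefore degenerate, and greedy coloring uses a
   bounded number of colors. For k >= 2, an average coloring of W with about
   |W|^((k-1)/d) colors makes at most |W|/2 facets monochromatic; hence half of
   W is properly colored, and one recurses on the rest with fresh colors. *)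
Require Import Defs.
From HB Require Import structures.
From mathcomp Require Import all_boot all_order all_algebra.
From mathcomp Require Import zify.
From mathcomp Require Import boolp reals exp Rstruct.

Set Implicit Arguments.
Unset Strict Implicit.
Unset Printing Implicit Defensive.
Import Order.TTheory GRing.Theory Num.Theory.

(** * Weak colorings of uniform hypergraphs *)

Definition edges_in (V : finType) (H : {set {set V}}) (W : {set V}) :=
  [set E in H | E \subset W].

Definition proper_on (V : finType) (H : {set {set V}}) (W : {set V}) (c : V -> nat) :=
  forall E, E \in edges_in H W -> forall i, ~~ (E \subset [set x | c x == i]).

(** Colors are plain naturals, bounded on [W] only, so that palettes can be shifted and colorings
    glued without casts. *)
Definition colorable_on (V : finType) (H : {set {set V}}) (W : {set V}) (m : nat) :=
  exists2 c : V -> nat, {in W, forall x, c x < m} & proper_on H W c.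

(** The colors used on [B] are shifted by [p]; the palettes are then disjoint, so a monochromatic
    edge lies entirely in [A] or entirely in [B]. *)
Lemma colorable_onU (V : finType) (H : {set {set V}}) (A B : {set V}) p q :
  colorable_on H A p -> colorable_on H B q -> colorable_on H (A :|: B) (p + q).
Proof.
move=> [f fA f_proper] [g gB g_proper].
exists (fun x => if x \in A then f x else p + g x) => [x|E].
  rewrite inE; case: ifP => [xA _|_ /= xB]; first exact: ltn_addr (fA x xA).
  by rewrite ltn_add2l gB.
rewrite inE => /andP[EH EAB] i; apply/negP => /subsetP Ei.
have Ec x : x \in E -> (if x \in A then f x else p + g x) = i.
  by move=> /Ei; rewrite inE => /eqP.
case: (ltnP i p) => [ip|pi].
  have EA : {subset E <= A}.
    move=> x /Ec; case: ifP => // _ xi.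
    by move: ip; rewrite -xi ltnNge leq_addr.
  have EinA : E \in edges_in H A by rewrite inE EH; apply/subsetP.
  apply: (negP (f_proper E EinA i)); apply/subsetP => x xE.
  by move: (Ec x xE); rewrite (EA x xE) inE => ->.
have EB x : x \in E -> (x \in B) /\ g x = i - p.
  move=> xE; have := Ec x xE; have := subsetP EAB x xE; rewrite inE.
  case: ifP => [xA _ xi|_ /= xB xi]; last by rewrite -xi addKn.
  by move: (fA x xA); rewrite xi ltnNge pi.
have EinB : E \in edges_in H B by rewrite inE EH; apply/subsetP => x /EB[].
apply: (negP (g_proper E EinB (i - p))); apply/subsetP => x /EB[_ xi].
by rewrite inE xi.
Qed.

Lemma card_mono (V : finType) (E : {set V}) (m : nat) (i : 'I_m) :
  #|[set f : {ffun V -> 'I_m} | E \subset [set x | f x == i]]| = m ^ (#|V| - #|E|).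
Proof.
set F := fun x => if x \in E then pred1 i else predT.
rewrite (@eq_card _ _ (family F)); last first.
  move=> f; rewrite inE; apply/subsetP/familyP => fE x.
    by rewrite /F; case: ifP => // /fE; rewrite !inE.
  by move=> xE; move: (fE x); rewrite /F xE !inE.
rewrite card_family foldrE big_image /=.
rewrite (bigID (mem E)) /= big1 => [|x xE]; last by rewrite /F xE card1.
rewrite mul1n (eq_bigr (fun=> m)) => [|x xE]; last first.
  by rewrite /F (negPf xE) card_ord.
by rewrite prod_nat_const -[in RHS](cardC E) addKn.
Qed.

(** First moment: an edge with d+1 vertices is monochromatic in a fraction m^-d of all colorings,
    and some coloring is no worse than the average. *)
Lemma few_mono_coloring (V : finType) (H : {set {set V}}) (d m : nat) :
  0 < m -> {in H, forall E : {set V}, #|E| = d.+1} ->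
  exists f : V -> 'I_m,
    #|[set E in H | [exists i, E \subset [set x | f x == i]]]| * m ^ d <= #|H|.
Proof.
move=> m_gt0 Hd.
pose mono (f : {ffun V -> 'I_m}) :=
  \sum_(E in H) \sum_(i < m) (E \subset [set x | f x == i] : nat).
have mono_sum : (\sum_f mono f) * m ^ d = #|H| * m ^ #|V|.
  rewrite exchange_big big_distrl -sum_nat_const; apply: eq_bigr => E EH /=.
  rewrite exchange_big (eq_bigr (fun=> m ^ (#|V| - d.+1))) => [|i _]; last first.
    by rewrite -(Hd E EH) -(card_mono E i) -sum1dep_card [RHS]big_mkcond /=;
      apply: eq_bigr => f _; case: (E \subset _).
  rewrite sum_nat_const card_ord -expnS -expnD; congr (_ ^ _).
  by have := max_card E; rewrite (Hd E EH) addSnnS; apply: subnK.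
case: (pickP [pred f | mono f * m ^ d <= #|H|]) => [f /= fH|no_f].
  exists f; apply: leq_trans fH; rewrite leq_mul2r; apply/orP; right.
  rewrite -sum1_card big_mkcond [X in _ <= X]big_mkcond leq_sum // => E _.
  rewrite inE; case: (E \in H) => //=; case: existsP => // -[i Ei].
  by rewrite (bigD1 i) //= Ei.
(* If every coloring exceeded the average, summing would contradict [mono_sum]; the coloring [f0]
   makes the summed inequality strict. *)
have := leqnn (#|H| * m ^ #|V|); rewrite -{1}mono_sum big_distrl /=.
have -> : m ^ #|V| = #|{ffun V -> 'I_m}| by rewrite card_ffun card_ord.
rewrite [X in _ <= X]mulnC -sum_nat_const leqNgt => /negP[].
have [f0 _] : exists f0 : {ffun V -> 'I_m}, true by exists [ffun=> Ordinal m_gt0].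
rewrite (bigD1 f0) //= [X in _ < X](bigD1 f0) //= -addSn leq_add //.
  by rewrite ltnNge; apply/negbT/no_f.
apply: leq_sum => f _; apply: ltnW; rewrite ltnNge; exact/negbT/no_f.
Qed.

(* Deleting one vertex of each monochromatic edge leaves a proper coloring. *)
Lemma colorable_half (V : finType) (H : {set {set V}}) (d m : nat) (W : {set V}) :
  0 < m -> {in H, forall E : {set V}, #|E| = d.+1} ->
  2 * #|edges_in H W| <= m ^ d * #|W| ->
  exists A : {set V}, [/\ A \subset W, 2 * #|W :\: A| <= #|W| & colorable_on H A m].
Proof.
move=> m_gt0 Hd HW.
have HWd : {in edges_in H W, forall E : {set V}, #|E| = d.+1}.
  by move=> E; rewrite inE => /andP[/Hd].
have [f] := few_mono_coloring m_gt0 HWd; set M := [set E in _ | _] => fM.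
pose r (E : {set V}) := [pick x in E].
pose B := [set x in W | [exists E in M, r E == Some x]].
have BM : #|B| <= #|M|.
  have -> : #|B| = #|[set Some x | x in B]| by rewrite card_imset //; exact: Some_inj.
  apply: leq_trans (leq_imset_card r M).
  apply/subset_leq_card/subsetP => _ /imsetP[x xB ->].
  move: xB; rewrite inE => /andP[_ /exists_inP[E EM /eqP <-]]; exact: imset_f.
exists (W :\: B); split; first exact: subsetDl.
  rewrite setDDr setDv set0U (setIidPr _); last first.
    by apply/subsetP => x; rewrite inE => /andP[].
  rewrite -(@leq_pmul2r (m ^ d)) ?expn_gt0 ?m_gt0 // [X in _ <= X]mulnC.
  apply: leq_trans HW; rewrite -mulnA leq_mul2l /=; apply: leq_trans fM.
  by rewrite leq_mul2r BM orbT.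
exists (fun x => f x : nat) => // E; rewrite inE => /andP[EH EWB] i.
apply/negP => Ei.
have E_gt0 : 0 < #|E| by rewrite (Hd E EH).
have [x rE xE] : exists2 x, r E = Some x & x \in E.
  by rewrite /r; case: pickP => [x xE|E0]; [exists x | rewrite (eq_card0 E0) in E_gt0].
have EM : E \in M.
  rewrite !inE EH (subset_trans EWB (subsetDl _ _)) /=; apply/existsP; exists (f x).
  apply/subsetP => y yE; rewrite inE; apply/eqP/val_inj.
  have := subsetP Ei y yE; have := subsetP Ei x xE; rewrite !inE => /eqP <-.
  by move/eqP.
have := subsetP EWB x xE; rewrite inE => /andP[/negP xB xW]; apply: xB.
by rewrite inE xW; apply/exists_inP; exists E; rewrite ?rE.
Qed.

(** Double counting of incident pairs of a vertex and an edge inside [W]. *)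
Lemma sum_degree (V : finType) (H : {set {set V}}) (d : nat) (W : {set V}) :
  {in H, forall E : {set V}, #|E| = d.+1} ->
  \sum_(x in W) #|[set E in edges_in H W | x \in E]| = d.+1 * #|edges_in H W|.
Proof.
move=> Hd; under eq_bigr => x _ do rewrite -sum1dep_card big_mkcondr /=.
rewrite exchange_big mulnC -sum_nat_const; apply: eq_bigr => E.
rewrite inE => /andP[/Hd <- /subsetP EW]; rewrite -big_mkcondr sum1dep_card.
by apply: eq_card => x; rewrite !inE; case xE: (x \in E); rewrite ?andbF ?(EW x xE).
Qed.

(* Greedy coloring along a degeneracy order. *)
Lemma colorable_degenerate (V : finType) (H : {set {set V}}) (d K : nat) :
  {in H, forall E : {set V}, #|E| = d.+2} ->
  (forall W : {set V}, #|edges_in H W| <= K * #|W|) ->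
  forall W : {set V}, colorable_on H W (d.+2 * K).+1.
Proof.
move=> Hd HK W; move: {2}#|W| (erefl #|W|) => N; elim: N W => [|N IHN] W cW.
  exists (fun=> 0) => // E; rewrite inE (cards0_eq cW) subset0 => /andP[EH /eqP E0].
  by have := Hd E EH; rewrite E0 cards0.
have [v vW deg_v] : exists2 v, v \in W & #|[set E in edges_in H W | v \in E]| <= d.+2 * K.
  apply/exists_inP; apply: contraT => /exists_inPn deg_big.
  have : d.+2 * #|edges_in H W| < d.+2 * #|edges_in H W|.
    rewrite -{2}(sum_degree W Hd); apply: (@leq_trans (\sum_(x in W) (d.+2 * K).+1)).
      have W_gt0 : 0 < #|W| by rewrite cW.
      by rewrite sum_nat_const mulnS -add1n leq_add // mulnCA leq_mul2l [_ * K]mulnC HK.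
    by apply: leq_sum => x xW; rewrite ltnNge deg_big.
  by rewrite ltnn.
have [|c cK c_proper] := IHN (W :\ v).
  by have := cardsD1 v W; rewrite vW cW add1n => -[].
(* Edges have at least two vertices, so each edge through [v] has another vertex [r E]. Avoiding its
   color at [v] suffices, so every such edge forbids only one color. *)
pose r (E : {set V}) := odflt v [pick x in E :\ v].
have rP E : E \in H -> r E \in E :\ v.
  move=> EH; rewrite /r; case: pickP => //= E0.
  by have := cardsD1 v E; rewrite (Hd E EH) (eq_card0 E0); case: (v \in E).
pose col E : 'I_(d.+2 * K).+1 := inord (c (r E)).
pose forbidden := col @: [set E in edges_in H W | v \in E].
have [k k_free] : exists k, k \notin forbidden.
  apply/existsP; rewrite -[[exists _, _]]negbK negb_exists; apply/negP => /forallP all_f.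
  have : #|forbidden| <= d.+2 * K := leq_trans (leq_imset_card col _) deg_v.
  rewrite leqNgt => /negP; apply.
  rewrite (@eq_card _ _ predT) ?card_ord // => k; have := all_f k.
  by rewrite negbK !inE.
exists (fun x => if x == v then k : nat else c x) => [x xW|E].
  by case: eqP => [_|/eqP xv] //; apply: cK; rewrite !inE xv.
rewrite inE => /andP[EH EW] i; apply/negP => /subsetP Ei.
have rE := rP E EH; have := rE; rewrite !inE => /andP[rv rEE].
have ci : c (r E) = i.
  by have := Ei _ rEE; rewrite inE (negPf rv) => /eqP.
case vE: (v \in E).
  have := Ei v vE; rewrite inE eqxx => /eqP ki.
  case/negP: k_free; apply/imsetP; exists E; first by rewrite !inE EH EW.
  by rewrite /col ci -ki inord_val.
have EWv : E \in edges_in H (W :\ v) by rewrite inE EH subsetD1 EW vE.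
apply: (negP (c_proper E EWv i)); apply/subsetP => x xE.
have := Ei x xE; rewrite !inE; case: (x =P v) => // xv.
by rewrite -xv xE in vE.
Qed.

(** * Generic vectors, ranks and dual bases *)

Local Open Scope ring_scope.

(* A point of the moment curve outside finitely many hyperplanes. *)
Lemma exists_generic (R : numFieldType) (D : nat) (T : finType) (u : T -> 'cV[R]_D) :
  exists c : 'rV[R]_D, forall t, u t != 0 -> (c *m u t) 0 0 != 0.
Proof.
pose p t : {poly R} := \sum_(j < D) u t j 0 *: 'X^j.
have p_neq0 t : u t != 0 -> p t != 0.
  apply: contraNneq => p0; apply/eqP/colP => j; rewrite mxE.
  have /(congr1 (fun q : {poly R} => q`_j)) := p0.
  rewrite coef0 coef_sum (bigD1 j) //= big1 => [|i ij].
    by rewrite addr0 coefZ coefXn eqxx mulr1.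
  by rewrite coefZ coefXn eq_sym val_eqE (negPf ij) mulr0.
pose q := \prod_(t | u t != 0) p t.
have q_neq0 : q != 0 by apply/prodf_neq0.
have [x q_x] : exists x, ~~ root q x.
  (* These are [size q] distinct elements, more than the nonzero [q] can have as roots. *)
  pose s := [seq i%:R : R | i <- iota 0 (size q)].
  have s_uniq : uniq s.
    by rewrite map_inj_uniq ?iota_uniq // => i j /eqP; rewrite eqr_nat => /eqP.
  have : ~~ all (root q) s.
    apply/negP => /(max_poly_roots q_neq0)/(_ s_uniq).
    by rewrite size_map size_iota ltnn.
  by case/allPn => x _ q_x; exists x.
pose c : 'rV[R]_D := \row_j x ^+ j.
exists c => t ut.
have -> : (c *m u t) 0 0 = (p t).[x].
  rewrite mxE horner_sum; apply: eq_bigr => j _.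
  by rewrite mxE hornerZ hornerXn mulrC.
apply: contra q_x => ptx; rewrite /root /q (bigD1 t) //= hornerM.
by rewrite (eqP ptx) mul0r.
Qed.

(** The matrix is a sum of #|S| matrices of rank at most one. *)
Lemma rank_row_support (F : fieldType) (n D : nat) (S : {set 'I_n}) (A : 'M[F]_(n, D)) :
  (forall i, i \notin S -> row i A = 0) -> (\rank A <= #|S|)%N.
Proof.
move=> A0; have decA : A = \sum_(i in S) delta_mx i 0 *m row i A.
  have {1}-> : A = \sum_i delta_mx i 0 *m row i A.
    apply/matrixP => j b; rewrite summxE (bigD1 j) //= big1 => [|i ij].
      by rewrite addr0 !mxE big_ord1 !mxE !eqxx mul1r.
    by rewrite !mxE big_ord1 !mxE eq_sym (negPf ij) mul0r.
  by rewrite (bigID (mem S)) /= [X in _ + X]big1 ?addr0 // => i iS; rewrite A0 // mulmx0.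
rewrite decA -sum1_card; elim/big_rec2: _ => [|i m B _ mB]; first by rewrite mxrank0.
apply: leq_trans (mxrank_add _ _) (leq_add _ mB).
by apply: leq_trans (mxrankM_maxr _ _) (rank_leq_row _).
Qed.

(** The matrix with rows [w i] has a left inverse [B], whose columns are the coordinate
    functionals. *)
Lemma dual_basis (F : fieldType) (n D : nat) (S : {set 'I_n}) (w : 'I_n -> 'rV[F]_D) :
  #|S| = D -> (D <= \rank (\matrix_(i < n) (if i \in S then w i else 0%R)))%N ->
  exists u : 'I_n -> 'cV[F]_D, {in S, forall i, u i != 0} /\
    forall c : 'rV[F]_D, c = \sum_(i in S) (c *m u i) 0 0 *: w i.
Proof.
set A := \matrix_i _ => SD rA.
have /row_fullP[B BA] : row_full A by rewrite /row_full eqn_leq rank_leq_col.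
exists (fun i => col i B); split=> [i iS|c].
  (* If column [i] of [B] vanished, [B] would still be a left inverse after deleting [w i], which
     leaves rank at most D-1. *)
  apply/negP => /eqP/colP Bi0; pose A' := \matrix_j (if j \in S :\ i then w j else 0).
  have BA' : B *m A' = 1%:M.
    rewrite -BA; apply/matrixP => a b; rewrite !mxE; apply: eq_bigr => k _.
    case: (eqVneq k i) => [->|ki]; last by rewrite !mxE !inE ki.
    by have := Bi0 a; rewrite !mxE => ->; rewrite !mul0r.
  have A'0 j : j \notin S :\ i -> row j A' = 0.
    by move=> jS; apply/rowP => a; rewrite !mxE (negPf jS) mxE.
  have := leq_trans (mxrankM_maxr B A') (rank_row_support A'0).
  by rewrite BA' mxrank1 -SD (cardsD1 i S) iS ltnn.
rewrite -[LHS]mulmx1 -BA mulmxA; apply/rowP => b; rewrite mxE summxE [RHS]big_mkcond /=.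
apply: eq_bigr => i _; rewrite !mxE; case: ifP => _; last by rewrite mxE mulr0.
by congr (_ * _); apply: eq_bigr => k _; rewrite !mxE.
Qed.

(** * Counting facets through the signs of a generic functional *)

Section SimplicialFamily.

Variables (R : realFieldType) (n D : nat) (w : 'I_n -> 'rV[R]_D).
Variables (H : {set {set 'I_n}}) (a : {set 'I_n} -> 'cV[R]_D).
Variable u : {set 'I_n} -> 'I_n -> 'cV[R]_D.

Hypothesis H_card : {in H, forall E : {set 'I_n}, #|E| = D}.
Hypothesis a_le1 : {in H, forall (E : {set 'I_n}) i, (w i *m a E) 0 0 <= 1}.
Hypothesis a_eq1 : {in H, forall (E : {set 'I_n}) i, ((w i *m a E) 0 0 == 1) = (i \in E)}.
Hypothesis u_dual : {in H, forall (E : {set 'I_n}) (c : 'rV[R]_D),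
  c = \sum_(i in E) (c *m u E i) 0 0 *: w i}.

(** In the polar polytope, with vertices [a E], these mark the edges at [a E] along which [c]
    increases. *)
Definition neg_part (c : 'rV[R]_D) (E : {set 'I_n}) :=
  [set i in E | (c *m u E i) 0 0 < 0].

(* Each term with negative [c *m u E i] is fixed, each positive one can only drop. *)
Lemma neg_part_max (c : 'rV[R]_D) (E G : {set 'I_n}) :
  E \in H -> G \in H -> {in E, forall i, (c *m u E i) 0 0 != 0} ->
  neg_part c E \subset G ->
  (c *m a G) 0 0 <= (c *m a E) 0 0 ?= iff (E == G).
Proof.
move=> EH GH c_neq0 /subsetP EG.
have ca F : F \in H -> (c *m a F) 0 0 = \sum_(i in E) (c *m u E i) 0 0 * (w i *m a F) 0 0.
  move=> FH; rewrite {1}(u_dual EH c) mulmx_suml summxE.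
  by apply: eq_bigr => i _; rewrite -scalemxAl mxE.
have EGE : (E == G) = [forall (i | i \in E), i \in G].
  rewrite eqEcard (H_card EH) (H_card GH) leqnn andbT.
  by apply/subsetP/forall_inP.
rewrite (ca E EH) (ca G GH) EGE; apply: leif_sum => i iE.
have /eqP -> := etrans (a_eq1 EH i) iE; rewrite mulr1.
have := c_neq0 i iE; rewrite neq_lt => /orP[c_lt0|c_gt0].
  have iG : i \in G by apply: EG; rewrite inE iE.
  have /eqP -> := etrans (a_eq1 GH i) iG.
  by rewrite mulr1 iG; exact: leif_refl.
split; first by rewrite ler_piMr ?a_le1 // ltW.
by rewrite -(a_eq1 GH) -{2}[(c *m u E i) 0 0]mulr1 (inj_eq (mulfI (lt0r_neq0 c_gt0))).
Qed.

(** Two facets with the same negative part both contain it, so [neg_part_max] applies in both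
    directions and its equality case identifies them. *)
Lemma neg_part_inj (c : 'rV[R]_D) :
  {in H, forall E : {set 'I_n}, {in E, forall i, (c *m u E i) 0 0 != 0}} ->
  {in H &, injective (neg_part c)}.
Proof.
move=> c_neq0 E G EH GH EG.
have sub F : neg_part c F \subset F by apply/subsetP => i; rewrite inE => /andP[].
have EsubG : neg_part c E \subset G by rewrite EG sub.
have GsubE : neg_part c G \subset E by rewrite -EG sub.
have le1 := neg_part_max EH GH (c_neq0 E EH) EsubG.
have le2 := neg_part_max GH EH (c_neq0 G GH) GsubE.
by apply/eqP; rewrite -le1 eq_le le1 le2.
Qed.

(** The negative parts of [E] for [c] and [- c] are disjoint subsets of a set of size [D], so one
    has at most [D./2] elements. For either sign, such a small part determines [E], whence the
    factor 2. *)
Lemma card_simplicial_le (W : {set 'I_n}) :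
  {in H, forall E : {set 'I_n}, {in E, forall i, u E i != 0}} ->
  (#|edges_in H W| <= 2 * #|[set S : {set 'I_n} | (S \subset W) && (#|S| <= D./2)%N]|)%N.
Proof.
move=> u_neq0.
have [c c_gen] := exists_generic (fun p : {set 'I_n} * 'I_n => u p.1 p.2).
have c_neq0 : {in H, forall E : {set 'I_n}, {in E, forall i, (c *m u E i) 0 0 != 0}}.
  by move=> E EH i iE; apply: (c_gen (E, i)); exact: u_neq0.
have Nc_neq0 : {in H, forall E : {set 'I_n}, {in E, forall i, (- c *m u E i) 0 0 != 0}}.
  by move=> E EH i iE; rewrite mulNmx mxE oppr_eq0 c_neq0.
set small := [set S | _].
pose half c' := [set E in edges_in H W | (#|neg_part c' E| <= D./2)%N].
have half_le c' :
    {in H, forall E : {set 'I_n}, {in E, forall i, (c' *m u E i) 0 0 != 0}} ->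
    (#|half c'| <= #|small|)%N.
  move=> c'_neq0; have inj : {in half c' &, injective (neg_part c')}.
    move=> E G; rewrite /half !inE => /andP[/andP[EH _] _] /andP[/andP[GH _] _].
    exact: neg_part_inj.
  rewrite -(card_in_imset inj); apply/subset_leq_card/subsetP => _ /imsetP[E + ->].
  rewrite /half /small !inE -andbA => /and3P[EH EW ->]; rewrite andbT.
  apply: subset_trans EW.
  by apply/subsetP => i; rewrite inE => /andP[].
apply: (@leq_trans #|half c :|: half (- c)|); last first.
  by rewrite mul2n -addnn (leq_trans (leq_card_setU _ _)) // leq_add ?half_le.
apply/subset_leq_card/subsetP => E; rewrite !inE => /andP[EH ->]; rewrite EH /=.
rewrite -implyNb -ltnNge; apply/implyP => big.
have disj : (#|neg_part c E| + #|neg_part (- c) E| <= D)%N.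
  rewrite -cardsUI -[X in (_ <= X)%N](H_card EH).
  have -> : neg_part c E :&: neg_part (- c) E = set0.
    apply/setP => i; rewrite !inE mulNmx [(- (c *m _)) 0 0]mxE oppr_lt0.
    by case: (i \in E) => //=; apply/negP => /andP[/lt_trans ci /ci]; rewrite ltxx.
  rewrite cards0 addn0; apply/subset_leq_card/subsetP => i.
  by rewrite !inE => /orP[] /andP[].
by move: big disj; move: #|_| #|_| => x y; clear; lia.
Qed.
End SimplicialFamily.

(** Each size j from 0 to k contributes at most |W|^j subsets, hence at most |W|^k as [W] is
    nonempty. *)
Lemma card_small_subsets (T : finType) (W : {set T}) (k : nat) : W != set0 ->
  (#|[set S : {set T} | (S \subset W) && (#|S| <= k)%N]| <= k.+1 * #|W| ^ k)%N.
Proof.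
rewrite -card_gt0 => W_gt0.
have bin_le N j : ('C(N, j) <= N ^ j)%N.
  apply: (@leq_trans (N ^_ j)); first by rewrite -bin_ffact leq_pmulr ?fact_gt0.
  elim: j => [|j IHj]; first by rewrite ffactn0.
  by rewrite ffactnSr expnSr leq_mul // leq_subr.
elim: k => [|k IHk].
  rewrite expn0 muln1 -(bin0 #|W|) -cards_draws; apply/subset_leq_card/subsetP => S.
  by rewrite !inE leqn0.
have -> : [set S : {set T} | (S \subset W) && (#|S| <= k.+1)%N] =
    [set S : {set T} | (S \subset W) && (#|S| <= k)%N] :|:
    [set S : {set T} | (S \subset W) && (#|S| == k.+1)].
  by apply/setP => S; rewrite !inE leq_eqVlt ltnS orbC andb_orr.
apply: leq_trans (leq_card_setU _ _) _; rewrite cards_draws mulSn addnC leq_add //.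
apply: leq_trans IHk _; rewrite leq_mul2l /=.
by rewrite leq_pexp2l.
Qed.

(** * Facet normals relative to an interior point *)

Section FacetNormal.

Variables (D n : nat) (v : 'I_n -> 'rV[Rdefinitions.R]_D) (p : 'rV[Rdefinitions.R]_D).

Lemma translate_hom_mx (F : {set 'I_n}) :
  hom_mx v F *m col_mx 1%:M (- p) = \matrix_i (if i \in F then v i - p else 0).
Proof.
apply/row_matrixP => i; rewrite row_mul !rowK; case: ifP => _; last by rewrite mul0mx.
by rewrite mul_row_col mulmx1; congr (_ + _); apply/rowP => j;
   rewrite !mxE big_ord1 !mxE mul1r.
Qed.

(** In homogeneous coordinates, (x, t) is sent to x - t p, with kernel spanned by (p, 1). The rows
    of [hom_mx v F] lie in the hyperplane a.x = b t, which misses (p, 1), so no rank is lost. *)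
Lemma rank_translate (F : {set 'I_n}) (a : 'cV_D) (b : Rdefinitions.R) :
  {in F, forall i, lin a (v i) = b} -> lin a p != b ->
  \rank (\matrix_i (if i \in F then v i - p else 0)) = aff_rank v F.
Proof.
move=> aF ap; rewrite -translate_hom_mx /aff_rank.
rewrite -(mxrank_mul_ker (hom_mx v F) (col_mx 1%:M (- p))).
suff -> : (hom_mx v F :&: kermx (col_mx 1%:M (- p)) = 0)%MS by rewrite mxrank0 addn0.
apply/eqP/rowV0P => x; rewrite sub_capmx => /andP[/submxP[y ->]] /sub_kermxP.
set z := y *m _ => zQ.
have za : z *m col_mx a (- b)%:M = 0.
  rewrite -mulmxA; suff -> : hom_mx v F *m col_mx a (- b)%:M = 0 by rewrite mulmx0.
  apply/row_matrixP => i; rewrite row_mul rowK row0.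
  case: ifP => iF; last by rewrite mul0mx.
  rewrite mul_row_col; apply/matrixP => i0 j0; rewrite !ord1 mxE [X in X + _]aF //.
  by rewrite !mxE big_ord1 !mxE eqxx mulr1n mul1r subrr.
move: za zQ; rewrite -[z]hsubmxK !mul_row_col mulmx1.
set x1 := lsubmx z; set t := rsubmx z; rewrite [t]mx11_scalar => za.
move/eqP; rewrite mul_scalar_mx scalerN subr_eq0 => /eqP x1E.
have t0 : t 0 0 = 0.
  move: za; rewrite x1E -scalemxAl -scalar_mxM => /matrixP/(_ 0 0)/eqP.
  rewrite !mxE eqxx mulr1n mulrN -mulrBr mulf_eq0 subr_eq0 => /orP[/eqP//|].
  by move: ap; rewrite /lin mxE => /negPf ->.
by rewrite x1E t0 scale0r raddf0 row_mx0.
Qed.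

End FacetNormal.

(** The barycenter lies at the average level of the vertices. Were that [b], all vertices would lie
    in [F], whose rank is too small for full dimension. *)
Lemma facet_gap (D n : nat) (v : 'I_n -> 'rV[Rdefinitions.R]_D)
    (F : {set 'I_n}) (a : 'cV_D) (b : Rdefinitions.R) :
  full_dimensional v -> (forall i, lin a (v i) <= b) ->
  F = [set i | lin a (v i) == b] -> aff_rank v F = D ->
  lin a (n%:R^-1 *: \sum_i v i) < b.
Proof.
move=> full ab FE FD.
have n_gt0 : (0 < n)%N.
  case: n v F full {ab FE FD} => // v F.
  by rewrite /full_dimensional /aff_rank flatmx0 mxrank0.
have n_neq0 : n%:R != 0 :> Rdefinitions.R by rewrite pnatr_eq0 -lt0n.
have linE : lin a (n%:R^-1 *: \sum_i v i) = n%:R^-1 * \sum_i lin a (v i).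
  by rewrite /lin -scalemxAl mxE mulmx_suml summxE.
have sumb : b = n%:R^-1 * \sum_(i < n) b.
  by rewrite sumr_const card_ord -[b *+ n]mulr_natl mulKf.
have le_sum := @leif_sum _ _ xpredT (fun i => lin a (v i) == b) _ _
  (fun i _ => leif_eq (ab i)).
rewrite linE [ltRHS]sumb ltr_pM2l ?invr_gt0 ?ltr0n // lt_neqAle le_sum.1 andbT le_sum.2.
apply/negP => /forallP all_b.
have FT : F = setT by apply/setP => i; rewrite FE !inE (implyP (all_b i)).
by move: full; rewrite /full_dimensional -FT FD => /n_Sn.
Qed.

(** The barycenter [p] serves as origin. Dividing by the positive gap [b - lin a p] moves each facet
    to level 1, and since its hyperplane misses [p], its translated vertices form a basis. *)
Lemma facets_in_le (D n : nat) (v : 'I_n -> 'rV[Rdefinitions.R]_D) (W : {set 'I_n}) :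
  simplicial_polytope v -> W != set0 ->
  (#|edges_in [set F | `[< facet_hypergraph v F >]] W| <= 2 * (D./2).+1 * #|W| ^ D./2)%N.
Proof.
move=> [_ full simpl] W0; set H := [set F | _].
pose p := n%:R^-1 *: \sum_i v i; pose w i := v i - p.
(* The guard [F \in H] lets [choice] produce a function on all sets; non-facets get the default
   0. *)
have normal F : exists a : 'cV[Rdefinitions.R]_D, F \in H ->
    (forall i, (w i *m a) 0 0 <= 1) /\ (forall i, ((w i *m a) 0 0 == 1) = (i \in F)).
  case FH: (F \in H); last by exists 0.
  move: FH; rewrite inE => /asboolP[a [b [ab FE FD]]].
  have gap := facet_gap full ab FE FD; rewrite -/p -subr_gt0 in gap.
  have wa i : (w i *m ((b - lin a p)^-1 *: a)) 0 0 =
      (lin a (v i) - lin a p) / (b - lin a p).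
    by rewrite -scalemxAr mxE mulrC mulmxBl; congr (_ / _); rewrite /lin !mxE.
  exists ((b - lin a p)^-1 *: a) => _; split=> i; rewrite wa.
    by rewrite ler_pdivrMr // mul1r lerB.
  rewrite FE inE -(inj_eq (mulIf (lt0r_neq0 gap))) divfK ?lt0r_neq0 // mul1r.
  by rewrite (inj_eq (addIr _)).
have [a aP] := choice normal.
have dual F : exists u : 'I_n -> 'cV[Rdefinitions.R]_D, F \in H ->
    {in F, forall i, u i != 0} /\
    forall c : 'rV_D, c = \sum_(i in F) (c *m u i) 0 0 *: w i.
  case FH: (F \in H); last by exists (fun=> 0).
  have FF : is_facet v F by move: FH; rewrite inE => /asboolP.
  have [a' [b [ab FE FD]]] := FF.
  have gap := facet_gap full ab FE FD.
  have [||u uP] := @dual_basis Rdefinitions.R n D F w; last by exists u.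
    exact: simpl.
  rewrite (@rank_translate _ _ _ _ _ a' b) ?FD //; last by rewrite lt_eqF.
  by move=> i; rewrite FE inE => /eqP.
have [u uP] := choice dual.
have H_card : {in H, forall F : {set 'I_n}, #|F| = D}.
  by move=> F; rewrite inE => /asboolP; exact: simpl.
apply: leq_trans (card_simplicial_le (w := w) (a := a) (u := u) H_card _ _ _ _ _) _.
- by move=> F FH; case: (aP F FH).
- by move=> F FH; case: (aP F FH).
- by move=> F FH; case: (uP F FH).
- by move=> F FH; case: (uP F FH).
by rewrite -mulnA leq_mul2l card_small_subsets.
Qed.

(** * The recursion with real exponents *)

(** With x the d-th root of K N^k, [m] is the integer part of x plus one. The estimate m <= x + 1 is
    absorbed using K^(1/d) <= K and 1 <= N^(k/d). *)
Lemma root_ceil (R : realType) (d K N k : nat) : (0 < d)%N -> (0 < K)%N -> (0 < N)%N ->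
  exists m : nat, [/\ (0 < m)%N, (K * N ^ k <= m ^ d)%N &
    m%:R <= (K%:R + 1) * N%:R `^ (k%:R / d%:R) :> R].
Proof.
move=> d_gt0 K_gt0 N_gt0; have d_neq0 : d%:R != 0 :> R by rewrite pnatr_eq0 -lt0n.
pose x : R := (K * N ^ k)%:R `^ d%:R^-1; have x_ge0 : 0 <= x := powR_ge0 _ _.
exists (Num.truncn x).+1; split=> //.
  rewrite -(ler_nat R) natrX; have <- : x ^+ d = (K * N ^ k)%:R.
    by rewrite -powR_mulrn // /x -powRrM mulVf // powRr1.
  by rewrite lerXn2r ?nnegrE // ltW // truncnS_gt.
have Npow : 1 <= N%:R `^ (k%:R / d%:R) :> R.
  by rewrite -[leLHS](powRr0 N%:R) ler_powR ?ler1n // divr_ge0.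
rewrite -natr1 mulrDl mul1r lerD //.
apply: le_trans (_ : x <= _); first by rewrite truncn_le.
rewrite /x natrM natrX powRM ?exprn_ge0 // -powR_mulrn // -powRrM ler_wpM2r ?powR_ge0 //.
by rewrite ler1_powR ?ler1n // invf_le1 ?ltr0n // ler1n.
Qed.

(* Each round colors half of [W], so the numbers of colors spent form a
   geometric series. *)
Lemma colorable_powR (R : realType) (V : finType) (H : {set {set V}}) (d k K : nat) :
  (0 < d)%N -> (0 < k)%N -> (0 < K)%N ->
  {in H, forall E : {set V}, #|E| = d.+1} ->
  (forall W : {set V}, W != set0 -> (#|edges_in H W| <= K * #|W| ^ k.+1)%N) ->
  forall W : {set V}, exists2 m : nat, colorable_on H W m &
    m%:R <= ((2 * K)%:R + 1) / (1 - 2^-1 `^ (k%:R / d%:R)) *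
      #|W|%:R `^ (k%:R / d%:R) :> R.
Proof.
move=> d_gt0 k_gt0 K_gt0 Hd HK; set al := k%:R / d%:R; set q : R := 2^-1 `^ al.
have al_gt0 : 0 < al :> R by rewrite divr_gt0 ?ltr0n.
have q_lt1 : 0 < 1 - q.
  have : q < 1 `^ al by rewrite gt0_ltr_powR ?nnegrE ?invr_ge0 // invf_lt1 ?ltr1n.
  by rewrite powR1 subr_gt0.
(* Halving [W] multiplies |W|^al by [q], and [C] solves 2K + 1 + C q = C, so the bound reproduces
   itself in the induction. *)
set C := _ / _; have C_ge0 : 0 <= C by apply: divr_ge0; [exact: addr_ge0 | exact: ltW].
move=> W; have [N] := ubnP #|W|; elim: N W => // N IHN W; rewrite ltnS => WN.
have [->|W0] := eqVneq W set0.
  exists 0%N; last by rewrite mulr_ge0 ?powR_ge0.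
  exists (fun=> 0%N) => [x|E]; first by rewrite inE.
  rewrite inE subset0 => /andP[EH /eqP E0].
  by have := Hd E EH; rewrite E0 cards0.
have W_gt0 : (0 < #|W|)%N by rewrite card_gt0.
have K2_gt0 : (0 < 2 * K)%N by rewrite muln_gt0.
have [m [m_gt0 m_ge m_le]] := root_ceil R k d_gt0 K2_gt0 W_gt0.
have few : (2 * #|edges_in H W| <= m ^ d * #|W|)%N.
  apply: leq_trans (_ : 2 * K * #|W| ^ k * #|W| <= _)%N; last first.
    by rewrite leq_mul2r m_ge orbT.
  by rewrite -!mulnA -expnSr leq_mul2l /= HK.
have [A [AW half Am]] := colorable_half m_gt0 Hd few.
have [|m' Bm' m'_le] := IHN (W :\: A); first by lia.
exists (m + m')%N.
  by have := colorable_onU Am Bm'; rewrite -{1}(setIidPr AW) setID.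
have B_le : #|W :\: A|%:R `^ al <= q * #|W|%:R `^ al.
  rewrite -powRM ?invr_ge0 // ge0_ler_powR ?nnegrE ?mulr_ge0 ?invr_ge0 ?(ltW al_gt0) //.
  by rewrite mulrC ler_pdivlMr // mulrC -natrM ler_nat.
rewrite natrD; apply: le_trans (lerD m_le m'_le) _.
apply: le_trans (lerD (lexx _) (ler_wpM2l C_ge0 B_le)) _.
rewrite mulrA -mulrDl ler_wpM2r ?powR_ge0 //.
by rewrite -lerBrDr -{1}[C]mulr1 -mulrBr /C divfK ?lt0r_neq0.
Qed.

(** * From colorings on vertex subsets to the chromatic number *)

(** The search in [chi] stops at #|V| and returns at most #|V|.+1, so an [m] beyond its range
    satisfies the bound trivially. *)
Lemma chi_le (V : finType) (H : hypergraph V) (m : nat) :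
  colorable_on [set E | `[< H E >]] setT m -> (chi H <= m)%N.
Proof.
move=> [c cm c_proper]; have Hm : `[< colorable H m >].
  apply/asboolP; exists (fun x => Ordinal (cm x (in_setT x))) => E EH i /subsetP Ei.
  have EinT : E \in edges_in [set E | `[< H E >]] setT.
    by rewrite !inE subsetT andbT; apply/asboolP.
  apply: (negP (c_proper E EinT i)); apply/subsetP => x /Ei.
  by rewrite !inE => /eqP <-.
rewrite leqNgt; apply/negP => lt_m.
have m_lt : (m < #|V|.+1)%N.
  by apply: leq_trans lt_m _; apply: leq_trans (find_size _ _) _; rewrite size_iota.
by have := before_find 0%N lt_m; rewrite nth_iota // add0n Hm.
Qed.

Theorem theorem1p4 (d : nat) (hd : (0 < d)%N) :
  exists C : Rdefinitions.R,
    forall (n : nat) (v : 'I_n -> 'rV[Rdefinitions.R]_(d.+1)),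
      (1 <= n)%N ->
      simplicial_polytope v ->
      ((chi (facet_hypergraph v))%:R : Rdefinitions.R)
        <= C * (n%:R `^ (((uphalf d).-1)%:R / d%:R)).
Proof.
(* The constant of [facets_in_le] in dimension d+1, where [(d.+1)./2] is [uphalf d], the ceiling of
   d/2. *)
pose K := (2 * (uphalf d).+1)%N.
have facets_card n (v : 'I_n -> 'rV[Rdefinitions.R]_(d.+1)) : simplicial_polytope v ->
    {in [set F | `[< facet_hypergraph v F >]], forall F : {set 'I_n}, #|F| = d.+1}.
  by case=> _ _ simpl F; rewrite inE => /asboolP; exact: simpl.
(* Exponent zero: the number of facets inside [W] is linear in |W|, and greedy coloring applies. The
   halving recursion would have ratio 1 here. *)
case k_eq: (uphalf d).-1 => [|k].
  have half1 : (uphalf d = 1)%N by case: d hd k_eq {K facets_card} => [|d]//=; lia.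
  exists (d.+1 * K).+1%:R => n v n_gt0 Pv.
  rewrite mul0r powRr0 mulr1 ler_nat; apply: chi_le.
  have := facets_card n v Pv.
  (* A successor [d] gives the edge size the form [d.+2] required by greedy coloring. *)
  case: d hd @K half1 v Pv {k_eq facets_card} => // d _ K half1 v Pv Hd.
  apply: (colorable_degenerate Hd) => W.
  have [->|W0] := eqVneq W set0; last first.
    by have := facets_in_le Pv W0; rewrite [_./2]half1 expn1 /K half1.
  rewrite cards0 muln0 leqn0 cards_eq0; apply/eqP/setP => E; rewrite inE subset0 [RHS]inE.
  by apply/andP => -[EH /eqP E0]; have := Hd E EH; rewrite E0 cards0.
(* The facet bound K |W|^(k+2) yields the exponent (k+1)/d, which is positive. *)
have half_k : uphalf d = k.+2 by move: k_eq; case: uphalf => //= ? ->.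
exists (((2 * K)%:R + 1) / (1 - 2^-1 `^ (k.+1%:R / d%:R))) => n v n_gt0 Pv.
have HK W : W != set0 ->
    (#|edges_in [set F | `[< facet_hypergraph v F >]] W| <= K * #|W| ^ k.+2)%N.
  by move=> W0; have := facets_in_le Pv W0; rewrite [(d.+1)./2]half_k /K half_k.
have [m chi_m] := @colorable_powR Rdefinitions.R _ _ _ _ K hd (ltn0Sn k) isT
  (facets_card n v Pv) HK setT.
by rewrite cardsT card_ord; apply: le_trans; rewrite ler_nat chi_le.
Qed.
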